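(* For any $m\in\mathbb{Z}\setminus\{0\}$ and $\xi\in\mathbb{Z}_m$, there exists an exact sequence of groups $1\to\mathbb{F}\to\overline{BS}(m,\xi)\to\mathbb{Z}\wr\mathbb{Z}\to 1$, where $\mathbb{F}$ is a free group.
   Context: A marked group on $k$ generators is a pair $(G,S)$ with $S=(s_1,\dots,s_k)\in G^k$ generating $G$, considered up to isomorphisms respecting the markings. $\mathcal{G}_k$ is the set of marked groups on $k$ generators with the ultrametric $d((G_1,S_1),(G_2,S_2))=e^{-\lambda}$, where $\lambda$ is the word length of a shortest element of the free group $\mathbb{F}_k$ that is trivial in one group and not in the other. For $m,n\in\mathbb{Z}\setminus\{0\}$, $BS(m,n)=\langle a,b\mid ab^ma^{-1}=b^n\rangle$, marked by $(a,b)$. The ring of $m$-adic integers is $\mathbb{Z}_m=\varprojlim_h \mathbb{Z}/m^h\mathbb{Z}$ (the zero ring if $|m|=1$). For $\xi\in\mathbb{Z}_m$, $\overline{BS}(m,\xi)=\lim_{n\to\infty}BS(m,\xi_n)$ in $\mathcal{G}_2$, where $(\xi_n)_n$ is any sequence of non-zero rational integers with $|\xi_n|\to\infty$ and $\xi_n\to\xi$ in $\mathbb{Z}_m$ (it is known that this limit exists and does not depend on the choice of $(\xi_n)_n$). $\mathbb{Z}\wr\mathbb{Z}=\mathbb{Z}\ltimes\mathbb{Z}[t,t^{-1}]$, where the generator of $\mathbb{Z}$ acts by multiplication by $t$. Free groups are allowed to have arbitrary rank (including rank $0$, i.e. the trivial group). *)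

(* Defs.v *)
From HB Require Import structures.
From mathcomp Require Import all_boot all_order all_algebra.
From mathcomp Require Import all_classical all_reals all_analysis.

Set Implicit Arguments.
Unset Strict Implicit.
Unset Printing Implicit Defensive.

Import Order.TTheory GRing.Theory Num.Theory.
Import numFieldNormedType.Exports.

Local Open Scope classical_set_scope.
Local Open Scope ring_scope.

(* A letter (x, false) stands for x, and (x, true) for its inverse. *)
Definition word (X : Type) := seq (X * bool).

Definition winv_letter (X : Type) (l : X * bool) : X * bool := (l.1, ~~ l.2).

Definition winv (X : Type) (w : word X) : word X :=
  rev (map (@winv_letter X) w).

Definition wpow (X : Type) (x : X) (z : int) : word X :=
  nseq `|z|%N (x, z < 0).

(* The congruence on words generated by the free cancellations and by the
   defining relations u = v for rel u v. *)
Inductive pres_eq (X : Type) (rel : word X -> word X -> Prop) :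
    word X -> word X -> Prop :=
| pres_refl u : pres_eq rel u u
| pres_sym u v : pres_eq rel u v -> pres_eq rel v u
| pres_trans v u w : pres_eq rel u v -> pres_eq rel v w -> pres_eq rel u w
| pres_cat u u' v v' :
    pres_eq rel u u' -> pres_eq rel v v' -> pres_eq rel (u ++ v) (u' ++ v')
| pres_cancel l : pres_eq rel [:: l; winv_letter l] [::]
| pres_rel u v : rel u v -> pres_eq rel u v.

Section Presented.
Variables (X : choiceType) (rel : word X -> word X -> Prop).

Definition pres_eqb (u v : word X) : bool := `[< pres_eq rel u v >].

Lemma pres_eqb_refl : reflexive pres_eqb.
Proof. by move=> u; apply/asboolP; exact: pres_refl. Qed.

Lemma pres_eqb_sym : symmetric pres_eqb.
Proof. by move=> u v; apply/asboolP/asboolP; exact: pres_sym. Qed.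

Lemma pres_eqb_trans : transitive pres_eqb.
Proof.
by move=> v u w /asboolP uv /asboolP vw; apply/asboolP; exact: pres_trans uv vw.
Qed.

Canonical pres_equiv :=
  EquivRel pres_eqb pres_eqb_refl pres_eqb_sym pres_eqb_trans.

Definition presented := {eq_quot pres_equiv}%qT.

HB.instance Definition _ := EqQuotient.on presented.
HB.instance Definition _ := Choice.on presented.

Definition pres_class (w : word X) : presented := \pi_presented%qT w.

Lemma pres_classP u v : pres_class u = pres_class v <-> pres_eq rel u v.
Proof.
by split=> [/eqmodP/asboolP | uv] //; apply/eqmodP/asboolP.
Qed.

Lemma pres_reprK (g : presented) : pres_class (repr g) = g.
Proof. exact: reprK. Qed.

Lemma pres_classE w : pres_eq rel (repr (pres_class w)) w.
Proof. by apply/pres_classP; rewrite pres_reprK. Qed.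

Definition pres_one : presented := pres_class [::].
Definition pres_mul (g h : presented) : presented :=
  pres_class (repr g ++ repr h).
Definition pres_inv (g : presented) : presented := pres_class (winv (repr g)).

Lemma winv_cat (u v : word X) : winv (u ++ v) = winv v ++ winv u.
Proof. by rewrite /winv map_cat rev_cat. Qed.

Lemma winv_letterK : involutive (@winv_letter X).
Proof. by case=> x b; rewrite /winv_letter /= negbK. Qed.

Lemma winvK : involutive (@winv X).
Proof.
by move=> w; rewrite /winv map_rev revK -map_comp map_id_in // => l _;
  exact: winv_letterK.
Qed.

Lemma pres_eq_mulwV w : pres_eq rel (w ++ winv w) [::].
Proof.
elim: w => [|l w IHw]; first exact: pres_refl.
rewrite -cat1s winv_cat catA -(catA [:: l]) -[[::]]/([::] ++ [::]).
apply: pres_trans (pres_cancel rel l).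
rewrite -[[:: l; _]]/([:: l] ++ [::] ++ [:: winv_letter l]) -catA.
apply: pres_cat; first exact: pres_refl.
by apply: pres_cat => //; exact: pres_refl.
Qed.

Lemma pres_classM u v :
  pres_mul (pres_class u) (pres_class v) = pres_class (u ++ v).
Proof. by apply/pres_classP/pres_cat; exact: pres_classE. Qed.

Lemma pres_eq_winv u v : pres_eq rel u v -> pres_eq rel (winv u) (winv v).
Proof.
move=> uv.
apply: (@pres_trans _ _ (winv u ++ (v ++ winv v))).
  rewrite -{1}(cats0 (winv u)); apply: pres_cat; first exact: pres_refl.
  by apply/pres_sym/pres_eq_mulwV.
rewrite catA -{2}[winv v]/([::] ++ winv v).
apply: pres_cat; last exact: pres_refl.
apply: (@pres_trans _ _ (winv u ++ u)).
  by apply: pres_cat; [exact: pres_refl | exact: pres_sym].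
by rewrite -{2}(winvK u); exact: pres_eq_mulwV.
Qed.

Lemma pres_classV u : pres_inv (pres_class u) = pres_class (winv u).
Proof. by apply/pres_classP/pres_eq_winv/pres_classE. Qed.

Lemma pres_mulA : associative pres_mul.
Proof.
move=> f g h; rewrite -(pres_reprK f) -(pres_reprK g) -(pres_reprK h).
by rewrite !pres_classM catA.
Qed.

Lemma pres_mul1 : left_id pres_one pres_mul.
Proof. by move=> g; rewrite -(pres_reprK g) pres_classM. Qed.

Lemma pres_mulr1 : right_id pres_one pres_mul.
Proof. by move=> g; rewrite -(pres_reprK g) pres_classM cats0. Qed.

Lemma pres_mulV : left_inverse pres_one pres_inv pres_mul.
Proof.
move=> g; rewrite -(pres_reprK g) pres_classV pres_classM.
apply/pres_classP; rewrite -{2}(winvK (repr g)); exact: pres_eq_mulwV.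
Qed.

Lemma pres_mulrV : right_inverse pres_one pres_inv pres_mul.
Proof.
move=> g; rewrite -(pres_reprK g) pres_classV pres_classM.
by apply/pres_classP; exact: pres_eq_mulwV.
Qed.

HB.instance Definition _ := isGroup.Build presented
  pres_mulA pres_mul1 pres_mulr1 pres_mulV pres_mulrV.

Definition pres_gen (x : X) : presented := pres_class [:: (x, false)].

End Presented.

Definition free_group (X : choiceType) := @presented X (fun _ _ => False).
HB.instance Definition _ (X : choiceType) :=
  Group.copy (free_group X) (@presented X (fun _ _ => False)).

Section FreeLift.
Variables (X : choiceType) (G : groupType) (f : X -> G).

Definition weval (w : word X) : G :=
  (\prod_(l <- w) (if l.2 then (f l.1)^-1 else f l.1))%g.

(* The homomorphism from the free group on X extending f. *)
Definition free_lift (g : free_group X) : G := weval (repr (g : presented _)).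

Lemma weval_cat u v : weval (u ++ v) = (weval u * weval v)%g.
Proof. by rewrite /weval big_cat. Qed.

Lemma weval_free u v : pres_eq (fun _ _ : word X => False) u v ->
  weval u = weval v.
Proof.
elim=> {u v} // [u v w _ -> _ -> //|u u' v v' _ uu' _ vv'|[x b]].
  by rewrite !weval_cat uu' vv'.
rewrite /weval big_cons big_seq1 big_nil /winv_letter /=.
by case: b; rewrite /= ?mulgV ?mulVg.
Qed.

Lemma free_lift_class w : free_lift (pres_class _ w) = weval w.
Proof. exact/weval_free/pres_classE. Qed.

Lemma free_liftM : {morph free_lift : g h / (g * h)%g}.
Proof.
move=> g h; rewrite -(pres_reprK g) -(pres_reprK h).
by rewrite [(_ * _)%g]pres_classM !free_lift_class weval_cat.
Qed.

Lemma free_lift_gen x : free_lift (pres_gen _ x) = f x.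
Proof. by rewrite free_lift_class /weval big_seq1. Qed.

End FreeLift.

Record marked_group (k : nat) := MarkedGroup {
  mcarrier :> groupType;
  mgens : 'I_k -> mcarrier;
  mgens_generate : forall g, exists w, free_lift mgens w = g }.

Lemma word_length_ex (X : choiceType) (g : free_group X) :
  exists n, `[< exists2 w : word X, pres_class _ w = g & size w = n >].
Proof.
exists (size (repr (g : presented _))); apply/asboolP.
by exists (repr (g : presented _)) => //; exact: pres_reprK.
Qed.

Definition word_length (X : choiceType) (g : free_group X) : nat :=
  ex_minn (word_length_ex g).

Section MarkedDist.
Variables (R : realType) (k : nat).

Definition separates (A B : marked_group k) (w : free_group 'I_k) : bool :=
  (free_lift (@mgens k A) w == 1%g) != (free_lift (@mgens k B) w == 1%g).

Definition separating_length (A B : marked_group k) (n : nat) : bool :=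
  `[< exists2 w, separates A B w & word_length w = n >].

(* The distance is 0 when no element separates A and B, that is, when A and B
   are isomorphic as marked groups; hence marked_group is the space of marked
   groups before passing to isomorphism classes. *)
Definition mdist (A B : marked_group k) : R :=
  match pselect (exists n, separating_length A B n) with
  | left h => expR (- (ex_minn h)%:R)
  | right _ => 0
  end.

Definition mcvg (u : nat -> marked_group k) (A : marked_group k) : Prop :=
  mdist (u n) A @[n --> \oo] --> (0 : R).

End MarkedDist.

Lemma pres_generate (X : choiceType) (rel : word X -> word X -> Prop)
  (g : presented rel) : exists w, free_lift (pres_gen rel) w = g.
Proof.
exists (pres_class _ (repr g)); rewrite free_lift_class -[RHS]pres_reprK.
elim: (repr g) => [|[x b] w IHw]; first by rewrite /weval big_nil.
rewrite -cat1s weval_cat IHw -[RHS]pres_classM /weval big_seq1 /=.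
by congr (_ * _)%g; case: b => //; exact: pres_classV.
Qed.

Definition bs_a : 'I_2 := ord0.
Definition bs_b : 'I_2 := ord_max.

Definition bs_rel (m n : int) (u v : word 'I_2) : Prop :=
  u = (bs_a, false) :: wpow bs_b m ++ [:: (bs_a, true)] /\ v = wpow bs_b n.

Definition BS (m n : int) : marked_group 2 :=
  @MarkedGroup 2 (presented (bs_rel m n)) (@pres_gen _ _)
    (@pres_generate _ _).

(* An element of the inverse limit of the Z/m^h, each component being given by
   its residue in [0, |m|^h[. *)
Record madic (m : int) := Madic {
  mcomp : forall h : nat, 'I_(`|m| ^ h);
  mcomp_coherent : forall h, (mcomp h.+1 = mcomp h %[mod `|m| ^ h])%N }.

(* Convergence of rational integers for the inverse limit topology, the Z/m^h
   being discrete. *)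
Definition madic_cvg (m : int) (x : nat -> int) (xi : madic m) : Prop :=
  forall h, \forall n \near \oo, (x n = (mcomp xi h)%:Z %[mod m ^+ h])%Z.

Definition BSbar_seq (m : int) (xi : madic m) (x : nat -> int) : Prop :=
  [/\ forall n, x n != 0,
      forall M : nat, \forall n \near \oo, (M <= `|x n|)%N
    & madic_cvg x xi].

Definition laurent_pred : {pred int -> int} :=
  fun c => `[< finite_set [set i | c i != 0] >].

Lemma laurent_pred_zmod : zmod_closed laurent_pred.
Proof.
split=> [|c d /asboolP cfin /asboolP dfin]; apply/asboolP.
  by rewrite (_ : [set i | _] = set0) // -subset0 => i /eqP.
apply: (sub_finite_set _ (_ : finite_set ([set i | c i != 0] `|`
  [set i | d i != 0]))); last by rewrite finite_setU.
move=> i /= cd; apply/orP; rewrite -negb_and; apply: contra cd.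
by move=> /andP[/eqP ci /eqP di]; rewrite !fctE ci di subrr.
Qed.

HB.instance Definition _ :=
  GRing.isZmodClosed.Build (int -> int) laurent_pred laurent_pred_zmod.

(* The additive group of Z[t, t^-1]: c stands for the sum of the c_i t^i. *)
Record laurent := Laurent {
  coef :> int -> int;
  coef_fin : coef \in laurent_pred }.

HB.instance Definition _ := [isSub for coef].
HB.instance Definition _ := [Choice of laurent by <:].
HB.instance Definition _ := [SubChoice_isSubZmodule of laurent by <:].

Lemma tmul_subproof (n : int) (c : laurent) :
  (fun i => c (i - n)) \in laurent_pred.
Proof.
apply/asboolP; have /asboolP cfin := coef_fin c.
apply: (sub_finite_set _ (finite_image (fun i => i + n) cfin)) => i /= ci.
by exists (i - n) => //; rewrite subrK.
Qed.

(* Multiplication by t^n. *)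
Definition tmul (n : int) (c : laurent) : laurent :=
  Laurent (tmul_subproof n c).

Lemma tmul0 c : tmul 0 c = c.
Proof. by apply/val_inj/funext => i /=; rewrite subr0. Qed.

Lemma tmul_tmul m n c : tmul m (tmul n c) = tmul (m + n) c.
Proof. by apply/val_inj/funext => i /=; rewrite opprD addrA. Qed.

Lemma tmulD n : {morph tmul n : c d / c + d}.
Proof. by move=> c d; apply/val_inj/funext => i. Qed.

Lemma tmulN n : {morph tmul n : c / - c}.
Proof. by move=> c; apply/val_inj/funext => i. Qed.

Definition ZwrZ := (int * laurent)%type.
HB.instance Definition _ := Choice.copy ZwrZ (int * laurent)%type.

Definition wr_one : ZwrZ := (0, 0).
Definition wr_mul (x y : ZwrZ) : ZwrZ := (x.1 + y.1, x.2 + tmul x.1 y.2).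
Definition wr_inv (x : ZwrZ) : ZwrZ := (- x.1, - tmul (- x.1) x.2).

Lemma wr_mulA : associative wr_mul.
Proof.
by move=> x y z; rewrite /wr_mul /= tmulD tmul_tmul !addrA.
Qed.

Lemma tmulr0 n : tmul n 0 = 0.
Proof. by apply/val_inj/funext. Qed.

Lemma wr_mul1 : left_id wr_one wr_mul.
Proof. by case=> n c; rewrite /wr_mul /= tmul0 !add0r. Qed.

Lemma wr_mulr1 : right_id wr_one wr_mul.
Proof. by case=> n c; rewrite /wr_mul /= tmulr0 !addr0. Qed.

Lemma wr_mulV : left_inverse wr_one wr_inv wr_mul.
Proof. by case=> n c; rewrite /wr_mul /= !addNr. Qed.

Lemma wr_mulrV : right_inverse wr_one wr_inv wr_mul.
Proof.
by case=> n c; rewrite /wr_mul /= tmulN tmul_tmul subrr tmul0 subrr.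
Qed.

HB.instance Definition _ := isGroup.Build ZwrZ
  wr_mulA wr_mul1 wr_mulr1 wr_mulV wr_mulrV.

Definition short_exact (A B C : groupType)
    (i : {multiplicative A -> B}) (p : {multiplicative B -> C}) : Prop :=
  [/\ injective i, range i = [set b | p b = 1%g] & range p = setT].

(* Main.v *)
Require Import Defs.
From HB Require Import structures.
From mathcomp Require Import all_boot all_order all_algebra.
From mathcomp Require Import all_classical all_reals all_analysis.
From mathcomp Require Import ring zify.

(** Let [L] be the limit of the groups [BS m (x n)], let [H <= L] consist of the
    elements that lie in [<b>] in almost all [BS m (x n)] with respect to a fixed
    non-principal ultrafilter, and let [B <= H] be defined by [<b^(x n)>] in the
    same way, so that [a^-1 B a <= H].  The group [L] acts on the graph with
    vertices [L / H] and edges [L / B].  A finite part of this graph embeds in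
    the graph of [BS m (x n)] for almost all [n], and there the sequence of edges
    crossed by a word depends only on the element it represents, up to
    cancellation, because the defining relation respects it; so the same holds
    in [L], which is all that is needed of the graph being a tree.
    The group [BS m (x n)] maps to the affine group of the rationals, [a] to the
    homothety of ratio [x n / m] and [b] to the unit translation.  A Laurent
    polynomial that vanishes at infinitely many of these ratios is zero, so [L]
    maps onto [Z wr Z], and the map is injective on [H].  Hence its kernel acts
    freely on the tree, and it is free on the edges between a subtree that is a
    transversal of the vertex orbits and its translates. *)

Set Implicit Arguments.
Unset Strict Implicit.
Unset Printing Implicit Defensive.

Import Order.TTheory GRing.Theory Num.Theory.

Local Open Scope classical_set_scope.
Local Open Scope ring_scope.

(** * Freeness of a kernel acting on a graph of cosets *)

Local Notation inv_closed B := (forall g, B g -> B g^-1)%g.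

Lemma morph_mul1 (G K : groupType) (f : G -> K) :
  {morph f : g h / (g * h)%g} -> f 1%g = 1%g.
Proof. by move=> fM; apply: (mulgI (f 1%g)); rewrite -fM !mulg1. Qed.

Definition group_morphism (G K : groupType) (f : G -> K)
    (fM : {morph f : g h / (g * h)%g}) : UMagmaMorphism.type G K :=
  HB.pack f (isMultiplicative.Build G K f fM)
    (Multiplicative_isUMagmaMorphism.Build G K f (morph_mul1 fM)).

(** Take the graph with the cosets [g H] as vertices and an edge from [g H] to [g a H]. Then [Y] is
    a connected union of vertices that meets each coset of the kernel of [p] exactly once.
    Connectedness is phrased as an induction principle starting at [1], and Zorn's lemma provides a
    maximal partial transversal of this kind. *)
Lemma subset_transversal (G Q : groupType) (p : UMagmaMorphism.type G Q)
    (H : set G) (a : G) :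
    H 1%g -> (forall g h, H g -> H h -> H (g * h)%g) -> inv_closed H ->
    (forall h, H h -> p h = 1%g -> h = 1%g) ->
    (forall P : set G, P 1%g -> (forall g h, H h -> P g -> P (g * h)%g) ->
       (forall g, P g -> P (g * a)%g) -> (forall g, P g -> P (g * a^-1)%g) ->
       P = setT) ->
  exists Y : set G, [/\ Y 1%g,
    forall y h, Y y -> H h -> Y (y * h)%g,
    forall y z, Y y -> Y z -> p y = p z -> y = z,
    forall g, exists2 y, Y y & p y = p g &
    forall P : set G, P 1%g -> (forall g h, H h -> P g -> P (g * h)%g) ->
      (forall y, Y y -> Y (y * a)%g -> P y <-> P (y * a)%g) -> Y `<=` P].
Proof.
move=> H1 HM HV Hp Hgen.
pose C (Y : set G) := [/\ Y !=set0 -> Y 1%g,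
    forall y h, Y y -> H h -> Y (y * h)%g,
    forall y z, Y y -> Y z -> p y = p z -> y = z &
    forall P : set G, P 1%g -> (forall g h, H h -> P g -> P (g * h)%g) ->
      (forall y, Y y -> Y (y * a)%g -> P y <-> P (y * a)%g) -> Y `<=` P].
have [F CF Ftot|Y [CY Ymax]] := @Zorn_bigcup _ C.
  split.
  - move=> [y [Z FZ Zy]]; have [Z1 _ _ _] := CF _ FZ.
    by exists Z => //; apply: Z1; exists y.
  - move=> y h [Z FZ Zy] Hh; have [_ ZH _ _] := CF _ FZ.
    by exists Z => //; exact: ZH.
  - move=> y z [Z FZ Zy] [Z' FZ' Zz].
    case: (Ftot _ _ FZ FZ') => ZZ.
      by have [_ _ inj _] := CF _ FZ'; apply: inj => //; exact: ZZ.
    by have [_ _ inj _] := CF _ FZ; apply: inj => //; exact: ZZ.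
  - move=> P P1 PH Pa y [Z FZ Zy]; have [_ _ _ conn] := CF _ FZ.
    apply: conn Zy => // z Zz Zza; apply: Pa; by exists Z.
have [YI YH Yinj Yconn] := CY.
have CH : C H.
  split=> [//|y h Hy Hh|y z Hy Hz pyz|P P1 PH _ h Hh]; first exact: HM.
  - apply: divg1_eq; apply: Hp; first by apply: HM => //; exact: HV.
    by rewrite gmulfF pyz mulgV.
  - by rewrite -[h]mul1g; exact: PH.
have Y1 : Y 1%g.
  apply: YI; apply: contrapT => Y0.
  apply: (Ymax H) => //; split; first by move=> y Yy; case: Y0; exists y.
  by move=> HY; apply: Y0; exists 1%g; exact: HY.
(* A maximal [Y] surjects: otherwise one more coset [z H] can be added. *)
have step y z : Y y -> (z = y * a \/ y = z * a)%g ->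
    exists2 y', Y y' & p y' = p z.
  move=> Yy yz; apply: contrapT => nz.
  have new h : H h -> ~ exists2 y', Y y' & p y' = p (z * h)%g.
    move=> Hh [y' Yy' E]; apply: nz; exists (y' * h^-1)%g.
      by apply: YH => //; exact: HV.
    by rewrite gmulfF E gmulfM mulgK.
  have zz : [set (z * h)%g | h in H] z by exists 1%g; rewrite ?mulg1.
  apply: (Ymax (Y `|` [set (z * h)%g | h in H])).
    split; first by move=> u; left.
    move=> sub; apply: nz; exists z => //; apply: sub; right; exact: zz.
  split=> [_|u h|u v|P P1 PH Pa u].
  - by left.
  - case=> [Yu Hh|[h' Hh' <-] Hh]; first by left; exact: YH.
    by right; exists (h' * h)%g; [exact: HM|rewrite mulgA].
  - case=> [Yu|[h Hh <-]] [Yv|[h' Hh' <-]] E; first exact: Yinj.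
    + by case: (new h' Hh'); exists u.
    + by case: (new h Hh); exists v; rewrite ?E.
    + congr (_ * _)%g; have [_ _ Hinj _] := CH; apply: Hinj => //.
      by apply: (mulgI (p z)); rewrite -!gmulfM.
  - have PY : Y `<=` P.
      by apply: Yconn => // w Yw Ywa; apply: Pa; left.
    case=> [/PY //|[h Hh <-]]; apply: PH => //.
    case: yz => E.
      by rewrite E; apply/(Pa y); [left|right; rewrite -E|exact: PY].
    by apply/(Pa z); [right|left; rewrite -E|rewrite -E; exact: PY].
exists Y; split=> // g.
suff : [set g | exists2 y, Y y & p y = p g] = setT.
  by move/seteqP => [_ /(_ g)]; apply.
move=> {g}; apply: Hgen => [|g h Hh [y Yy E]|g [y Yy E]|g [y Yy E]].
- by exists 1%g.
- by exists (y * h)%g; [exact: YH|rewrite !gmulfM E].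
- have [y' Yy' E'] := step y (y * a)%g Yy (or_introl erefl).
  by exists y' => //; rewrite E' !gmulfM E.
- have [|y' Yy' E'] := step y (y * a^-1)%g Yy; first by right; rewrite mulgVK.
  by exists y' => //; rewrite E' !gmulfM E.
Qed.

Lemma free_lift_ker (X : choiceType) (G Q : groupType) (f : X -> G)
    (p : UMagmaMorphism.type G Q) (u : free_group X) :
  (forall x, p (f x) = 1%g) -> p (free_lift f u) = 1%g.
Proof.
move=> pf; rewrite /free_lift /weval gmulf_prod big1 // => -[x []] _ /=.
  by rewrite gmulfV pf invg1.
exact: pf.
Qed.

(* The cocycle [c] is the substitute for the Bass-Serre tree: [c g g'] reads
   the labels [f] of the edges crossed by a path from [g H] to [g g' H], the
   edges being the cosets of [B], and the existence of [c] says that closed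
   paths are null-homotopic. *)
Lemma kernel_free (G Q : groupType) (p : UMagmaMorphism.type G Q)
    (H B : set G) (a : G) :
    H 1%g -> (forall g h, H g -> H h -> H (g * h)%g) -> inv_closed H ->
    B `<=` H -> (forall g, B g -> H (g ^ a)%g) ->
    (forall h, H h -> p h = 1%g -> h = 1%g) ->
    (forall P : set G, P 1%g -> (forall g h, H h -> P g -> P (g * h)%g) ->
       (forall g, P g -> P (g * a)%g) -> (forall g, P g -> P (g * a^-1)%g) ->
       P = setT) ->
    (forall (X : choiceType) (f : G -> free_group X),
       (forall g h, B h -> f (g * h)%g = f g) ->
       exists c : G -> G -> free_group X,
         [/\ forall g, c g a = f g, forall g h, H h -> c g h = 1%g &
         forall g g1 g2, c g (g1 * g2)%g = (c g g1 * c (g * g1) g2)%g]) ->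
    range p = setT ->
  exists (X : choiceType) (i : {multiplicative free_group X -> G}),
    short_exact i p.
Proof.
move=> H1 HM HV BH BaH Hp Hgen Hcoc psurj.
have [Y [Y1 YH Yinj Ysurj Yconn]] := subset_transversal H1 HM HV Hp Hgen.
have /choice[T HT] : forall g, exists y, Y y /\ p y = p g.
  by move=> g; have [y Yy E] := Ysurj g; exists y.
have TE g y : Y y -> p y = p g -> T g = y.
  by move=> Yy E; have [YT ET] := HT g; apply: Yinj => //; rewrite ET.
have TH g h : H h -> T (g * h)%g = (T g * h)%g.
  move=> Hh; have [YT ET] := HT g; apply: TE; first exact: YH.
  by rewrite !gmulfM ET.
have TY y : Y y -> T y = y by move=> Yy; exact: TE.
have Tp g g' : p g = p g' -> T g = T g'.
  by move=> E; have [YT ET] := HT g'; apply: TE => //; rewrite ET.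
(* The edge leaving [T g] ends at [T g * a = phi g * T (g * a)], so [phi g] is the kernel element
   whose translate of [Y] is entered. It is [1] when the edge stays in [Y]. *)
pose phi g := (T g * a * (T (g * a))^-1)%g.
have phip g : p (phi g) = 1%g.
  by rewrite !gmulfM gmulfV !(HT _).2 gmulfM mulgV.
have phiN g g' : p g = p g' -> phi g = phi g'.
  by move=> E; rewrite /phi (Tp g g') // (Tp (g * a)%g (g' * a)%g) // !gmulfM E.
have phiB g h : B h -> phi (g * h)%g = phi g.
  move=> Bh; rewrite /phi TH; last exact: BH.
  have -> : (g * h * a)%g = (g * a * (h ^ a))%g by rewrite conjgE !mulgA mulgK.
  rewrite (TH _ _ (BaH _ Bh)) conjgE !invgM !invgK !mulgA.
  by rewrite !mulgK.
(* The basis consists of the non-trivial values of [phi]; [f] labels an edge by its value, or by [1]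
   if that value is trivial. *)
pose Xp : pred G := fun x => `[< x <> 1%g /\ exists g, phi g = x >].
pose X : choiceType := {x : G | Xp x}.
pose f g : free_group X :=
  if insub (phi g) is Some x then pres_gen _ x else 1%g.
have fN g g' : p g = p g' -> f g = f g' by move=> E; rewrite /f (phiN _ _ E).
have f1 g : phi g = 1%g -> f g = 1%g.
  by rewrite /f => ->; case: insubP => // x /asboolP[].
have [i iE] : exists i : UMagmaMorphism.type (free_group X) G,
    forall u, i u = free_lift (fun x : X => val x) u.
  by exists (group_morphism (free_liftM (fun x : X => val x))).
have i_f g : i (f g) = phi g.
  rewrite /f; case: insubP => [x _ <-|]; first by rewrite iE free_lift_gen.
  move=> /asboolPn E; rewrite gmulf1.
  apply/esym; apply: contrapT => ne.
  by apply: E; split=> //; exists g.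
have [g h Bh|c [ca cH cM]] := Hcoc X f; first by rewrite /f phiB.
have caV g : c g a^-1%g = ((f (g * a^-1))^-1)%g.
  apply: (mulIg (f (g * a^-1)%g)); rewrite mulVg -ca -cM mulVg; exact: cH.
(* The representatives telescope along a path. For [g = 1] and [g'] in the kernel this says
   [i (c 1 g') = g'], so the range of [i] contains the kernel. *)
have i_c g : forall g', i (c g g') = (T g * g' * (T (g * g'))^-1)%g.
  move=> g'; suff : [set g' | i (c g g') = (T g * g' * (T (g * g'))^-1)%g] = setT.
    by move=> /seteqP[_ /(_ g')]; apply.
  apply: Hgen => /= [|k h Hh E|k E|k E].
  - by rewrite cH // gmulf1 !mulg1 mulgV.
  - rewrite cM (cH _ h) // mulg1 E (mulgA g) (TH _ h) // invgM !mulgA.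
    by rewrite mulgK.
  - rewrite cM ca gmulfM E i_f /phi !mulgA.
    by rewrite mulgVK.
  - rewrite cM caV gmulfM gmulfV i_f E /phi !invgM !invgK !mulgA.
    by rewrite !mulgVK.
have cN g g0 : p g = p g0 -> forall g', c g g' = c g0 g'.
  move=> gg0 g'; 
  suff : [set g' | c g g' = c g0 g'] = setT by move=> /seteqP[_ /(_ g')]; apply.
  apply: Hgen => /= [|k h Hh E|k E|k E].
  - by rewrite !cH.
  - by rewrite !cM E !(cH _ h).
  - by rewrite !cM E !ca; congr (_ * _)%g; apply: fN; rewrite !gmulfM gg0.
  - by rewrite !cM E !caV; congr (_ * _^-1)%g; apply: fN; rewrite !gmulfM gg0.
have cY y : Y y -> c 1%g y = 1%g.
  apply: (Yconn [set y | c 1%g y = 1%g]) => /= [|g h Hh E|{}y Yy Yya].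
  - by rewrite cH.
  - by rewrite cM E (cH _ h) // mulg1.
  - rewrite cM mul1g ca f1 ?mulg1 //.
    by rewrite /phi !TY // mulgV.
(* The path of [x = T g * a * (T (g * a))^-1] runs inside [Y] to [T g], crosses one edge labelled
   [x], and returns inside the translate of [Y] by [x]. Only that edge contributes. *)
have cphi x : c 1%g (val x) = pres_gen _ x :> free_group X.
  have /asboolP[_ [g E]] := valP x.
  rewrite -E /phi -mulgA cM mul1g cM cY ?mul1g; last exact: (HT g).1.
  rewrite ca (fN _ g) ?(HT g).2 //.
  have -> : c (T g * a)%g ((T (g * a))^-1)%g = 1%g.
    apply: (mulIg (c (T g * a / T (g * a)) (T (g * a)))%g).
    rewrite -cM mulVg mul1g cH // (cN _ 1%g) ?cY //; first exact: (HT _).1.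
    by rewrite [LHS](phip g) gmulf1.
  rewrite mulg1 /f E.
  by case: insubP => [x' _ /val_inj -> //|/negP[]]; exact: valP.
(* By [cN], [c 1] is multiplicative on the kernel, so its values on the generators make it a left
   inverse of [i]. *)
have ic w : c 1%g (i (pres_class _ w)) = pres_class _ w.
  rewrite iE free_lift_class.
  elim: w => [|[x b] w IHw]; first by rewrite /weval big_nil cH.
  have E : c 1%g (if b then (val x)^-1%g else val x) = pres_class _ [:: (x, b)].
    case: b => /=; last exact: cphi.
    have px : p (1 * (val x)^-1)%g = p 1%g.
      by have /asboolP[_ [g <-]] := valP x; rewrite mul1g gmulfV phip gmulf1 invg1.
    apply: (mulIg (c 1%g (val x))).
    rewrite -{1}(cN _ _ px (val x)) -cM mulVg cH // cphi.
    apply/esym; rewrite [LHS]pres_classM; apply/pres_classP.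
    exact: (pres_cancel _ (x, true)).
  rewrite -cat1s weval_cat cM mul1g {1}/weval big_seq1 E.
  rewrite (cN _ 1%g); last first.
    have /(_ (pres_class _ [:: (x, b)])) := @free_lift_ker X G Q (fun x => val x) p.
    rewrite free_lift_class /weval big_seq1 gmulf1; apply => x'.
    by have /asboolP[_ [g <-]] := valP x'; exact: phip.
  by rewrite IHw [LHS]pres_classM.
have iK : cancel i (c 1%g).
  by move=> u; have := ic (repr (u : presented _)); rewrite pres_reprK.
exists X, i; split=> //; first exact: can_inj iK.
apply/seteqP; split=> [_ [u _ <-]|g /= pg] /=.
  rewrite iE; apply: free_lift_ker => x.
  by have /asboolP[_ [g <-]] := valP x; exact: phip.
exists (c 1%g g) => //; rewrite i_c mul1g (Tp g 1%g) ?gmulf1 //.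
by rewrite !TY // invg1 mulg1 mul1g.
Qed.

(** * Evaluation of words and cyclic subgroups *)

Section Generated.
Variables (X : choiceType) (G : groupType) (s : X -> G).

Lemma weval_winv (w : word X) : weval s (winv w) = ((weval s w)^-1)%g.
Proof.
elim: w => [|[x b] w IHw]; first by rewrite /weval !big_nil invg1.
rewrite -cat1s winv_cat !weval_cat invgM IHw; congr (_ * _)%g.
by rewrite /weval /winv /= !big_seq1 /=; case: b => //=; rewrite invgK.
Qed.

Lemma weval1 l : weval s [:: l] = if l.2 then ((s l.1)^-1)%g else s l.1.
Proof. by rewrite /weval big_seq1. Qed.

Lemma weval_nseq n l : weval s (nseq n l) = (weval s [:: l] ^+ n)%g.
Proof.
elim: n => [|n IHn]; first by rewrite /weval big_nil.
by rewrite expgS -IHn -weval_cat.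
Qed.

Lemma marking_word (gen : forall g, exists w, free_lift s w = g) g :
  exists w, weval s w = g.
Proof.
by have [w <-] := gen g; exists (repr (w : presented _)).
Qed.

End Generated.

Lemma weval_pres (X : choiceType) (rel : word X -> word X -> Prop) w :
  weval (pres_gen rel) w = pres_class rel w.
Proof.
elim: w => [|[x b] w IHw]; first by rewrite /weval big_nil.
rewrite -cat1s weval_cat IHw -[RHS]pres_classM weval1.
by congr (_ * _)%g; case: b => //; exact: pres_classV.
Qed.

(** The cyclic subgroup of [g]; writing exponents as differences of naturals avoids case
    distinctions on signs. *)
Definition powers (G : groupType) (g : G) : set G :=
  [set h | exists k l : nat, h = (g ^+ k * g ^- l)%g].

Lemma powers1 (G : groupType) (g : G) : powers g 1%g.
Proof. by exists 0%N, 0%N; rewrite !expg0 mulgV. Qed.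

Lemma powersM (G : groupType) (g h k : G) :
  powers g h -> powers g k -> powers g (h * k)%g.
Proof.
move=> [i [j ->]] [i' [j' ->]]; exists (i + i')%N, (j' + j)%N.
rewrite !expgnDr invgM !mulgA; congr (_ * _)%g; rewrite -!mulgA; congr (_ * _)%g.
exact/commute_sym/commuteV/commuteX2.
Qed.

Lemma powersV (G : groupType) (g h : G) : powers g h -> powers g (h^-1)%g.
Proof. by move=> [i [j ->]]; exists j, i; rewrite invgM invgK. Qed.

Lemma powers_id (G : groupType) (g : G) : powers g g.
Proof. by exists 1%N, 0%N; rewrite expg0 divg1 expg1. Qed.

Lemma powersX (G : groupType) (g h : G) n : powers g h -> powers g (h ^+ n)%g.
Proof.
by move=> gh; elim: n => [|n IHn]; [exact: powers1|rewrite expgS; exact: powersM].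
Qed.

Lemma sub_powers (G : groupType) (g h : G) : powers g h -> powers h `<=` powers g.
Proof.
by move=> gh _ [i [j ->]]; apply: powersM; [|apply: powersV]; exact: powersX.
Qed.

Lemma powersJ (G : groupType) (g h x : G) :
  powers g h -> powers (g ^ x)%g (h ^ x)%g.
Proof.
by move=> [i [j ->]]; exists i, j; rewrite conjMg conjVg !conjXg.
Qed.

(* [edge_word s f g w] multiplies the labels [f] of the edges [(h, h a)] crossed
   by the path that starts at [g] and reads [w] in the Cayley graph. *)
Fixpoint edge_word (G K : groupType) (s : 'I_2 -> G) (f : G -> K) (g : G)
    (w : word 'I_2) : K :=
  if w is l :: w' then
    let h := (g * weval s [:: l])%g in
    ((if l.1 == bs_a then if l.2 then (f h)^-1 else f g else 1)
       * edge_word s f h w')%g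
  else 1%g.

(** * Labels of paths and their invariance in [BS m n] *)

Section EdgeWord.
Variables (G K : groupType) (s : 'I_2 -> G) (f : G -> K).
Local Notation cw := (edge_word s f).

Lemma edge_word_cat g u v :
  cw g (u ++ v) = (cw g u * cw (g * weval s u) v)%g.
Proof.
elim: u g => [|l u IHu] g; first by rewrite /weval big_nil mulg1 /= mul1g.
by rewrite /= IHu -(cat1s l u) weval_cat !mulgA.
Qed.

Lemma edge_word_nseq_b g n b : cw g (nseq n (bs_b, b)) = 1%g.
Proof. by elim: n g => //= n IHn g; rewrite IHn mulg1. Qed.

(** Only the labels at the prefixes of a path matter, so a path can be carried from the limit to an
    approximating group. *)
Lemma edge_word_transfer (G' : groupType) (s' : 'I_2 -> G') (f' : G' -> K) w u :
  (forall i, (i <= size u)%N ->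
     f (weval s (w ++ take i u)) = f' (weval s' (w ++ take i u))) ->
  cw (weval s w) u = edge_word s' f' (weval s' w) u.
Proof.
elim: u w => [//|l u IHu] w ff' /=.
have f0 := ff' 0%N isT; rewrite take0 cats0 in f0.
have f1 := ff' 1%N isT; rewrite /= take0 in f1.
rewrite -!weval_cat f0 f1 IHu // => i iu.
by rewrite -catA cat1s; exact: (ff' i.+1).
Qed.

End EdgeWord.

(** An element of the subgroup of [b] is also spelled by a word in [b] alone, which crosses no
    edge. *)
Lemma edge_word_powers (G K : groupType) (s : 'I_2 -> G) (f : G -> K) g u :
  (forall v, weval s u = weval s v -> edge_word s f g u = edge_word s f g v) ->
  powers (s bs_b) (weval s u) -> edge_word s f g u = 1%g.
Proof.
move=> wd [k [l E]].
rewrite (wd (nseq k (bs_b, false) ++ nseq l (bs_b, true))).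
  by rewrite edge_word_cat !edge_word_nseq_b mulg1.
by rewrite E weval_cat !weval_nseq !weval1 /= expVgn.
Qed.

Section BSCocycle.
Variables (m n : int) (K : groupType).
Local Notation rel := (bs_rel m n).
Local Notation s := (pres_gen rel).
Local Notation gb := (weval s (wpow bs_b n)).
Variable f : presented rel -> K.
Hypothesis f_gb : forall g, f (g * gb)%g = f g.

Lemma BS_rel : weval s ((bs_a, false) :: wpow bs_b m ++ [:: (bs_a, true)]) = gb.
Proof. by rewrite !weval_pres; apply/pres_classP; exact: pres_rel. Qed.

(** Induction on the congruence. In the defining relation the two letters [a] and its inverse
    contribute [f g] and the inverse of [f (g * gb)], which cancel by [f_gb]; the powers of [b]
    contribute nothing. *)
Lemma edge_word_BS u v g : weval s u = weval s v ->
  edge_word s f g u = edge_word s f g v.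
Proof.
rewrite !weval_pres => /pres_classP uv.
elim: uv g => {u v} // [u v w _ uv _ vw g|u u' v v' uu' IHu _ IHv g|l g|u v [-> ->] g].
- by rewrite uv.
- rewrite !edge_word_cat IHu IHv !weval_pres.
  by congr (_ * edge_word _ _ (_ * _) _)%g; apply/pres_classP.
- case: l => x b; rewrite /= mulg1 /winv_letter /=.
  case: eqP => _; last by rewrite mulg1.
  rewrite !weval1; case: b => /=; first by rewrite mulVg.
  by rewrite mulgK mulgV.
- rewrite /wpow edge_word_nseq_b -cat1s !edge_word_cat edge_word_nseq_b mul1g.
  rewrite /= !mulg1 -!mulgA -!weval_cat /= BS_rel f_gb.
  by rewrite mulgV.
Qed.

End BSCocycle.

(** * Passage to the limit along an ultrafilter *)

Lemma filter_seq (T : eqType) (I : Type) (F : set_system I) {FF : Filter F}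
    (r : seq T) (P : T -> set I) :
  (forall t, t \in r -> F (P t)) -> F [set n | forall t, t \in r -> P t n].
Proof.
elim: r => [|t r IHr] FP; first exact: filterE.
apply: filterS2 (FP t (mem_head _ _)) (IHr _) => [n Pt Pr u|u ur].
  by rewrite inE => /predU1P[->|/Pr].
by apply: FP; rewrite inE ur orbT.
Qed.

Section Limit.
Variables (M : nat -> marked_group 2) (e : forall n, M n) (L : marked_group 2).
Variables (U : set_system nat) (UU : UltraFilter U).
Local Notation evL := (weval (@mgens 2 L)).
Local Notation ev n := (weval (@mgens 2 (M n))).
Hypothesis M_cocycle : forall n (K : groupType) (f : M n -> K) u v g,
  (forall h, f (h * e n)%g = f h) -> ev n u = ev n v ->
  edge_word (@mgens 2 (M n)) f g u = edge_word (@mgens 2 (M n)) f g v.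
Hypothesis e_b : forall n, powers (mgens (M n) bs_b) (e n).
Hypothesis eJ_b : forall n, powers (mgens (M n) bs_b) (e n ^ mgens (M n) bs_a)%g.
Hypothesis evU :
  forall w, U [set n | (ev n w == 1%g) = (evL w == 1%g)].

Lemma limit_eqP u v : evL u = evL v <-> U [set n | ev n u = ev n v].
Proof.
have E (N : marked_group 2) : (weval (@mgens 2 N) (u ++ winv v) == 1%g) =
    (weval (@mgens 2 N) u == weval (@mgens 2 N) v).
  by rewrite weval_cat weval_winv divg_eq1.
have := evU (u ++ winv v); rewrite /= E => H; split=> [/eqP uv|uv].
  by apply: filterS H => n /=; rewrite E uv => /eqP.
by have [n [/= + uvn]] := filter_ex (filterI H uv); rewrite E uvn eqxx => /esym/eqP.
Qed.

Definition limit_word (g : L) : word 'I_2 :=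
  projT1 (cid (marking_word (@mgens_generate 2 L) g)).

Lemma limit_wordK g : evL (limit_word g) = g.
Proof. by rewrite /limit_word; case: cid. Qed.

Definition limit_set (P : forall n, set (M n)) : set L :=
  [set g | U [set n | P n (ev n (limit_word g))]].

(** Words for the same element of [L] agree in [U]-almost all [M n], so the choice made by
    [limit_word] is immaterial. *)
Lemma limit_setE P u : limit_set P (evL u) <-> U [set n | P n (ev n u)].
Proof.
have := (limit_eqP (limit_word (evL u)) u).1 (limit_wordK _) => E.
by split; apply: filterS2 E => n /= ->.
Qed.

Lemma limit_set1 P : (forall n, P n 1%g) -> limit_set P 1%g.
Proof.
move=> P1; have -> : 1%g = evL [::] by rewrite /weval big_nil.
by apply/limit_setE; apply: filterE => n /=; rewrite /weval big_nil; exact: P1.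
Qed.

Lemma limit_setM P : (forall n g h, P n g -> P n h -> P n (g * h)%g) ->
  forall g h, limit_set P g -> limit_set P h -> limit_set P (g * h)%g.
Proof.
move=> PM g h; rewrite -(limit_wordK g) -(limit_wordK h) -weval_cat !limit_setE.
by move=> Pg Ph; apply: filterS2 Pg Ph => n; rewrite /= weval_cat; exact: PM.
Qed.

Lemma limit_setV P : (forall n g, P n g -> P n g^-1%g) ->
  forall g, limit_set P g -> limit_set P g^-1%g.
Proof.
move=> PV g; rewrite -(limit_wordK g) -weval_winv !limit_setE.
by apply: filterS => n; rewrite /= weval_winv; exact: PV.
Qed.

Definition vertex_stab : set L :=
  limit_set (fun n => powers (mgens (M n) bs_b)).

Definition edge_stab : set L :=
  limit_set (fun n => powers ((e n))).

Lemma edge_stab_vertex : edge_stab `<=` vertex_stab.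
Proof.
move=> g; apply: filterS => n; exact: sub_powers.
Qed.

Lemma edge_stabJ g : edge_stab g -> vertex_stab (g ^ mgens L bs_a)%g.
Proof.
pose w := winv [:: (bs_a, false)] ++ limit_word g ++ [:: (bs_a, false)].
have wE (N : marked_group 2) : weval (@mgens 2 N) w =
    (weval (@mgens 2 N) (limit_word g) ^ mgens N bs_a)%g.
  by rewrite !weval_cat weval_winv weval1.
rewrite -[g in vertex_stab (g ^ _)%g]limit_wordK -wE => Bg.
apply/limit_setE; apply: filterS Bg => n Bg.
suff : powers (mgens (M n) bs_b) (ev n w) by [].
by rewrite wE; apply: (sub_powers (@eJ_b n)); exact: powersJ.
Qed.

(** For [U]-almost all [n], words of the finite list [r] that share a coset of the powers of [e n]
    already share a coset of [edge_stab] in [L]. Hence [f] descends to these cosets. *)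
Lemma limit_labels (K : groupType) (f : L -> K) (r : seq (word 'I_2)) :
  (forall g h, edge_stab h -> f (g * h)%g = f g) ->
  U [set n | exists2 fn : M n -> K,
      forall g, fn (g * (e n))%g = fn g &
      forall w, w \in r -> fn (ev n w) = f (evL w)].
Proof.
move=> fB.
suff : U [set n | forall w, w \in r -> forall w', w' \in r ->
    powers (e n) ((ev n w')^-1 * ev n w)%g -> f (evL w') = f (evL w)].
  apply: filterS => n good.
  (* [S g] depends only on the coset of [g], so the label chosen through it is invariant under
     [e n]. Cosets missed by [r] get the default label [1]. *)
  pose S g := [set w | w \in r /\ powers (e n) ((ev n w)^-1 * g)%g].
  exists (fun g => if `[< S g !=set0 >] then f (evL (xget [::] (S g))) else 1%g).
    move=> g; suff -> : S (g * e n)%g = S g by [].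
    apply/seteqP; split=> w [wr Sw]; split=> //.
      rewrite -[g](mulgK (e n)) mulgA; apply: powersM => //.
      by apply: powersV; exact: powers_id.
    by rewrite mulgA; apply: powersM => //; exact: powers_id.
  move=> w wr; have Sw : S (ev n w) w by split; rewrite ?mulVg //; exact: powers1.
  case: asboolP => [_|[]]; last by exists w.
  by have [w'r] := xgetI [::] Sw; exact: good.
apply: (filter_seq (P := fun w => [set n | forall w', w' \in r ->
    powers (e n) ((ev n w')^-1 * ev n w)%g -> f (evL w') = f (evL w)])) => w _.
apply: (filter_seq (P := fun w' => [set n |
    powers (e n) ((ev n w')^-1 * ev n w)%g -> f (evL w') = f (evL w)])) => w' _.
(* Maximality of [U]: either the two cosets differ for almost all [n], or they agree for almost all
   [n], which places the quotient in [edge_stab]. *)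
have [UA|UA] := in_ultra_setVsetC
    [set n | powers (e n) ((ev n w')^-1 * ev n w)%g] UU; last first.
  by apply: filterS UA => n /= nA /nA.
apply: filterE => n _; rewrite -[evL w](mulVKg (evL w')) fB //.
rewrite -weval_winv -weval_cat; apply/limit_setE.
by apply: filterS UA => n' /=; rewrite weval_cat weval_winv.
Qed.

Lemma limit_edge_word (K : groupType) (f : L -> K) g (r : seq (word 'I_2)) :
  (forall g h, edge_stab h -> f (g * h)%g = f g) ->
  U [set n | exists (fn : M n -> K) h,
      (forall g, fn (g * (e n))%g = fn g) /\
      forall u, u \in r ->
        edge_word (@mgens 2 L) f g u = edge_word (@mgens 2 (M n)) fn h u].
Proof.
move=> fB; pose w := limit_word g.
(* The list holds every prefix, the full word included, translated by a word for [g]. *)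
have := limit_labels
  [seq w ++ take i u | u <- r, i <- iota 0 (size u).+1] fB.
apply: filterS => n [fn fn_b fnE]; exists fn, (ev n w); split=> // u ur.
rewrite -{1}[g]limit_wordK; apply: edge_word_transfer => i iu.
by apply/esym/fnE/allpairsPdep; exists u, i; rewrite mem_iota.
Qed.

(** Any single identity between path labels involves finitely many vertices, so it can be checked in
    one well-chosen [M n], where [M_cocycle] applies. *)
Lemma limit_cocycle (K : groupType) (f : L -> K) :
  (forall g h, edge_stab h -> f (g * h)%g = f g) ->
  exists c : L -> L -> K,
    [/\ forall g, c g (mgens L bs_a) = f g,
        forall g h, vertex_stab h -> c g h = 1%g &
        forall g g1 g2, c g (g1 * g2)%g = (c g g1 * c (g * g1) g2)%g].
Proof.
move=> fB; pose cw := edge_word (@mgens 2 L) f.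
have wd g u v : evL u = evL v -> cw g u = cw g v.
  move=> /limit_eqP uv.
  have [n [/= E [fn [h [fn_b fnE]]]]] :=
    filter_ex (filterI uv (limit_edge_word g [:: u; v] fB)).
  rewrite /cw !fnE ?inE ?eqxx ?orbT //; exact: M_cocycle.
exists (fun g h => cw g (limit_word h)); split=> [g|g h Hh|g g1 g2].
- rewrite (wd _ _ [:: (bs_a, false)]); last by rewrite limit_wordK weval1.
  by rewrite /cw /= mulg1.
- have [n [/= E [fn [k [fn_b fnE]]]]] :=
    filter_ex (filterI Hh (limit_edge_word g [:: limit_word h] fB)).
  by rewrite /cw fnE ?inE //; apply: edge_word_powers E => v; exact: M_cocycle.
- rewrite (wd _ _ (limit_word g1 ++ limit_word g2)).
    by rewrite /cw edge_word_cat limit_wordK.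
  by rewrite weval_cat !limit_wordK.
Qed.

End Limit.

(** * Words in the wreath product and the affine action *)

Lemma laurent_delta_subproof (i z : int) :
  (fun j => if j == i then z else 0) \in laurent_pred.
Proof.
apply/asboolP; apply: (@sub_finite_set _ _ [set i]); last exact: finite_set1.
by move=> j /=; case: (j =P i) => // _; rewrite eqxx.
Qed.

Definition laurent_delta (i z : int) : laurent :=
  Laurent (laurent_delta_subproof i z).

Definition wr_mark (x : 'I_2) : ZwrZ :=
  if x == bs_a then (1, 0) else (0, laurent_delta 0 1).

Lemma weval_wpow (X : choiceType) (G : groupType) (s : X -> G) x (z : int) :
  weval s (wpow x z) = (if z < 0 then s x ^- `|z| else s x ^+ `|z|)%g.
Proof. by rewrite /wpow weval_nseq weval1 /=; case: ifP; rewrite ?expVgn. Qed.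

Lemma wr_expa (n : nat) : (((1%R, 0%R) : ZwrZ) ^+ n)%g = (n%:Z, 0) :> ZwrZ.
Proof.
elim: n => // n IHn; rewrite expgS IHn; congr (_, _).
by rewrite /= tmulr0 addr0.
Qed.

Lemma wr_expb (c : laurent) (n : nat) :
  (((0%R, c) : ZwrZ) ^+ n)%g = (0, c *+ n) :> ZwrZ.
Proof.
elim: n => // n IHn; rewrite expgS IHn; congr (_, _) => /=.
by rewrite tmul0 mulrS.
Qed.

Lemma laurent_coefD (c d : laurent) i : (c + d) i = c i + d i.
Proof. by []. Qed.

Lemma laurent_coefN (c : laurent) i : (- c) i = - c i.
Proof. by []. Qed.

Lemma laurent_coefMn (c : laurent) n i : (c *+ n) i = c i *+ n.
Proof. by elim: n => // n IHn; rewrite !mulrS laurent_coefD IHn. Qed.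

Lemma wr_mark_wpow_a z : weval wr_mark (wpow bs_a z) = (z, 0).
Proof.
rewrite weval_wpow /wr_mark eqxx !wr_expa; case: ltP => z0.
  rewrite ltz0_abs //; congr (_, _); rewrite ?opprK //.
  by apply: val_inj; apply/funext => i /=; rewrite oppr0.
by rewrite gez0_abs.
Qed.

Lemma wr_mark_wpow_b z : weval wr_mark (wpow bs_b z) = (0, laurent_delta 0 z).
Proof.
have E n : laurent_delta 0 1 *+ n = laurent_delta 0 n.
  apply/val_inj/funext => i; rewrite /= laurent_coefMn /=.
  by case: ifP => _; rewrite ?mul0rn // pmulrn intz.
rewrite weval_wpow /wr_mark /= wr_expb E; case: ltP => z0.
  congr (_, _); rewrite ?oppr0 //=; apply/val_inj/funext => i /=.
  by rewrite fctE subr0; case: ifP => _; rewrite ?oppr0 // ltz0_abs ?opprK.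
by rewrite gez0_abs.
Qed.

Lemma wr_mark_surj y : exists w, weval wr_mark w = y.
Proof.
suff H (r : seq int) (c : laurent) : (forall i, i \notin r -> c i = 0) ->
    exists w, weval wr_mark w = (0, c).
  case: y => k c; have /asboolP/finite_seqP[r rE] := coef_fin c.
  have [i ir|w E] := H r c.
    apply/eqP; apply: contraNT ir => ci.
    by have : [set i | c i != 0] i := ci; rewrite rE.
  exists (w ++ wpow bs_a k); rewrite weval_cat E wr_mark_wpow_a.
  by congr (_, _) => /=; rewrite ?add0r // tmulr0 addr0.
elim: r c => [|j r IHr] c cr.
  exists [::]; rewrite /weval big_nil; congr (_, _).
  by apply/val_inj/funext => i /=; rewrite cr.
have [i ir|w E] := IHr (c - laurent_delta j (c j)).
  rewrite laurent_coefD laurent_coefN /=; case: eqP => [->|/eqP ij].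
    by rewrite subrr.
  by rewrite cr ?subr0 // inE negb_or ij.
(* Conjugating the power [c j] of [b] by the power [j] of [a] yields the monomial of degree [j]. *)
exists (wpow bs_a j ++ wpow bs_b (c j) ++ wpow bs_a (- j) ++ w).
rewrite !weval_cat E !wr_mark_wpow_a wr_mark_wpow_b; congr (_, _) => /=.
  by rewrite !add0r addr0 subrr.
apply/val_inj/funext => i /=; rewrite !fctE.
have -> : i - j - 0 - - j = i by ring.
by rewrite subr_eq0 !add0r addrC subrK.
Qed.

(* The affine action on the rationals with [a] acting as the homothety of ratio
   [t] and [b] as the unit translation, together with the exponent of [a]. *)
Definition aff_letter (t : rat) (l : 'I_2 * bool) (y : int * rat) : int * rat :=
  if l.1 == bs_a then
    if l.2 then (y.1 - 1, t^-1 * y.2) else (y.1 + 1, t * y.2)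
  else if l.2 then (y.1, y.2 - 1) else (y.1, y.2 + 1).

Definition aff (t : rat) (w : word 'I_2) (y : int * rat) : int * rat :=
  foldr (aff_letter t) y w.

Lemma aff_cat t u v y : aff t (u ++ v) y = aff t u (aff t v y).
Proof. exact: foldr_cat. Qed.

Lemma aff_nseq_b t n b y :
  aff t (nseq n (bs_b, b)) y = (y.1, y.2 + (-1) ^+ b * n%:R).
Proof.
elim: n => [|n IHn] /=; first by rewrite mulr0 addr0; case: y.
by rewrite IHn /aff_letter /= -natr1; case: b {IHn}; congr (_, _) => /=; ring.
Qed.

Lemma aff_wpow_b t z y : aff t (wpow bs_b z) y = (y.1, y.2 + z%:~R).
Proof.
rewrite /wpow aff_nseq_b; congr (_, _ + _); case: ltP => z0.
  by rewrite expr1 mulN1r -{2}[z]opprK -(ltz0_abs z0) mulrNz -pmulrn.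
by rewrite mul1r -{2}(gez0_abs z0) -pmulrn.
Qed.

(** The homothety of ratio [t] conjugates the translation by [m] to the one by [t * m], so
    [t * m = n] is what the relation requires. *)
Lemma aff_pres_eq (m n : int) t u v : t != 0 -> t * m%:~R = n%:~R ->
  pres_eq (bs_rel m n) u v -> aff t u =1 aff t v.
Proof.
move=> t0 tE; elim=> {u v} //
  [u v _ uv y|u v w _ uv _ vw y|u u' v v' _ uu' _ vv' y|[x b] y|u v [-> ->] y].
- by rewrite uv.
- by rewrite uv.
- by rewrite !aff_cat vv' uu'.
- rewrite /= /aff_letter /winv_letter /=; case: y => i z.
  by case: eqP => _; case: b => /=; congr (_, _);
    rewrite ?addrK ?subrK // ?mulKf ?mulVKf.
- rewrite -cat1s !aff_cat !aff_wpow_b /= /aff_letter /=.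
  by congr (_, _); rewrite ?subrK // mulrDr tE mulVKf.
Qed.

Lemma bs_b_neq (x : 'I_2) : x != bs_a -> x = bs_b.
Proof. by case: x => [[|[|]]] // ? ?; apply: val_inj. Qed.

Lemma wr_mark_letter l : weval wr_mark [:: l] =
  if l.1 == bs_a then ((-1) ^+ l.2, 0) else (0, laurent_delta 0 ((-1) ^+ l.2)).
Proof.
case: l => x b /=; case: eqVneq => [->|/bs_b_neq ->].
  by case: b; [exact: (wr_mark_wpow_a (-1))|exact: (wr_mark_wpow_a 1)].
by case: b; [exact: (wr_mark_wpow_b (-1))|exact: (wr_mark_wpow_b 1)].
Qed.

Lemma aff_wr_mark w : exists (K : nat) (q : {poly int}),
  [/\ forall j : nat, (weval wr_mark w).2 (j%:Z - K%:Z) = q`_j,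
      forall i, i < - K%:Z -> (weval wr_mark w).2 i = 0 &
      forall t, t != 0 ->
        aff t w (0, 0) = ((weval wr_mark w).1, t ^- K * (map_poly intr q).[t])].
Proof.
elim: w => [|l w [K [q [qE q0 affE]]]].
  exists 0%N, 0; split=> [j|i _|t t0]; rewrite /weval big_nil ?coef0 //.
  by rewrite map_poly0 horner0 mulr0.
have wE1 : (weval wr_mark (l :: w)).1 =
    (weval wr_mark [:: l]).1 + (weval wr_mark w).1.
  by rewrite -cat1s weval_cat.
have wE2 i : (weval wr_mark (l :: w)).2 i =
    (weval wr_mark [:: l]).2 i + (weval wr_mark w).2 (i - (weval wr_mark [:: l]).1).
  by rewrite -cat1s weval_cat.
have affE' t : aff t (l :: w) (0, 0) = aff_letter t l (aff t w (0, 0)) by [].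
move: wE1 wE2; rewrite wr_mark_letter => wE1 wE2.
case: l wE1 wE2 affE' => x b; rewrite /aff_letter /=.
case: eqP => _ /= wE1 wE2 affE'; last first.
  (* The letter adds a constant, which becomes a multiple of ['X^K] after the shift. *)
  exists K, (q + (-1) ^+ b *: 'X^K); split=> [j|i iK|t t0].
  - rewrite wE2 /= subr0 qE coefD coefZ coefXn addrC subr_eq0 eqz_nat.
    by case: eqP; rewrite ?mulr1 ?mulr0.
  - rewrite wE2 /= subr0 q0 // addr0; case: eqP => // i0.
    by move: iK; rewrite i0 oppr_gt0 ltNge le0z_nat.
  - rewrite affE' wE1 affE // add0r rmorphD /= map_polyZ map_polyXn hornerD.
    rewrite hornerZ hornerXn mulrDr mulrCA mulVf ?expf_neq0 // mulr1.
    by case: b {wE1 wE2 affE'}; rewrite /= ?rmorph1 ?rmorphN1.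
case: b wE1 wE2 affE' => wE1 wE2 affE'.
  exists K.+1, q; split=> [j|i iK|t t0].
  - by rewrite wE2 -qE /= add0r; congr coef; rewrite intS; ring.
  - rewrite wE2 /= add0r q0 //; move: iK; lia.
  - rewrite affE' wE1 affE // addrC; congr (_, _).
    by rewrite exprS invfM mulrA.
exists K, (q * 'X); split=> [j|i iK|t t0].
- rewrite wE2 /= add0r coefMX; case: j => [|j] /=; first by rewrite q0 //; lia.
  by rewrite -qE; congr coef; rewrite intS; ring.
- by rewrite wE2 /= add0r q0 //; lia.
- rewrite affE' wE1 affE // addrC; congr (_, _).
  by rewrite rmorphM /= map_polyX hornerM hornerX; ring.
Qed.

(** * Vanishing of polynomials and convergence of marked groups *)

Lemma poly_roots_bounded (F : realFieldType) (q : {poly F}) : q != 0 ->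
  exists M, forall t, root q t -> `|t| <= M.
Proof.
have [n] := ubnP (size q); elim: n q => // n IHn q qn q0.
have [[r rq]|nr] := pselect (exists r, root q r); last first.
  by exists 0 => t qt; case: nr; exists t.
have /factor_theorem[q' qE] := rq.
have q'0 : q' != 0 by apply: contraNneq q0 => q'0; rewrite qE q'0 mul0r.
have [|M HM] := IHn q' _ q'0.
  by move: qn; rewrite qE size_Mmonic ?monicXsubC // size_XsubC addn2.
exists (Num.max M `|r|) => t; rewrite qE rootM root_XsubC le_max.
by case/orP => [/HM ->//|/eqP ->]; rewrite lexx orbT.
Qed.

Lemma mdist_separates (R : realType) (k : nat) (A B : marked_group k)
    (w : free_group 'I_k) :
  separates A B w -> expR (- (word_length w)%:R) <= Defs.mdist R A B.
Proof.
move=> sw; have sl : separating_length A B (word_length w).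
  by apply/asboolP; exists w.
rewrite /Defs.mdist; case: pselect => [ex|[]]; last by exists (word_length w).
by rewrite ler_expR lerN2 ler_nat; case: ex_minnP => n _; exact.
Qed.

(** A word on which the groups disagree keeps their distance above a positive constant depending
    only on the word. *)
Lemma mcvg_weval (R : realType) (k : nat) (M : nat -> marked_group k)
    (L : marked_group k) (w : word 'I_k) : mcvg R M L ->
  \forall n \near \oo,
    (weval (@mgens k (M n)) w == 1%g) = (weval (@mgens k L) w == 1%g).
Proof.
pose l := word_length (pres_class _ w : free_group 'I_k).
move=> /cvgr_lt /(_ _ (expR_gt0 (- l%:R))).
apply: filterS => n; apply: contraTeq; rewrite -leNgt => sep.
by apply: mdist_separates; rewrite /separates !free_lift_class.
Qed.

Lemma poly_int_vanishing (m : int) (x : nat -> int) (U : set_system nat)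
    {PU : ProperFilter U} (q : {poly int}) :
  m != 0 -> (forall M : nat, U [set n | (M <= `|x n|)%N]) ->
  U [set n | root (map_poly intr q) ((x n)%:~R / m%:~R : rat)] -> q = 0.
Proof.
move=> m0 xU qU; apply/eqP; apply: contraT => q0.
have [|M HM] := @poly_roots_bounded _ (map_poly (intr : int -> rat) q).
  by rewrite map_poly_eq0_id0 // intr_eq0 lead_coef_eq0.
(* The successor of the truncation makes the absolute value of [x n / m] strictly exceed the root
   bound [M]. *)
have [n [/= qn xn]] := filter_ex (filterI qU (xU (Num.truncn (M * `|m|%:~R)).+1)).
have := HM _ qn; rewrite normrM normfV ler_pdivrMr ?normr_gt0 ?intr_eq0 // leNgt.
rewrite -!intr_norm => /negP[].
apply: (lt_le_trans (truncnS_gt _)).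
by rewrite -[in leRHS]abszE -pmulrn ler_nat.
Qed.

(** * The exact sequence *)

Lemma BSbar_kernel_free (m : int) (x : nat -> int) (L : marked_group 2)
    (U : set_system nat) (UU : UltraFilter U) :
  m != 0 -> (forall n, x n != 0) ->
  (forall M : nat, U [set n | (M <= `|x n|)%N]) ->
  (forall w, U [set n | (weval (@mgens 2 (BS m (x n))) w == 1%g) =
                        (weval (@mgens 2 L) w == 1%g)]) ->
  exists (X : choiceType) (i : {multiplicative free_group X -> L})
    (p : {multiplicative L -> ZwrZ}), short_exact i p.
Proof.
move=> m0 x0 xU evU.
pose M n := BS m (x n).
pose e n : M n := weval (@mgens 2 (M n)) (wpow bs_b (x n)).
pose t n : rat := (x n)%:~R / m%:~R.
have t0 n : t n != 0 by rewrite mulf_neq0 ?invr_eq0 ?intr_eq0.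
have tm n : t n * m%:~R = (x n)%:~R by rewrite divfK ?intr_eq0.
have M_cocycle n (K : groupType) (f : M n -> K) u v g :
    (forall h, f (h * e n)%g = f h) ->
    weval (@mgens 2 (M n)) u = weval (@mgens 2 (M n)) v ->
    edge_word (@mgens 2 (M n)) f g u = edge_word (@mgens 2 (M n)) f g v.
  by move=> fe uv; apply: edge_word_BS.
have pow_b n z : powers (mgens (M n) bs_b) (weval (@mgens 2 (M n)) (wpow bs_b z)).
  rewrite weval_wpow; case: ifP => _; last exact/powersX/powers_id.
  exact/powersV/powersX/powers_id.
(* By the relation, conjugating [e n] by [a] gives the power [m] of [b]. *)
have eJ_b n : powers (mgens (M n) bs_b) (e n ^ mgens (M n) bs_a)%g.
  rewrite -[e n]BS_rel -cat1s !weval_cat !weval1 /= conjgE !mulgA mulVg mul1g.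
  by rewrite mulgVK; exact: (pow_b n m).
have aff_eq n u v : weval (@mgens 2 (M n)) u = weval (@mgens 2 (M n)) v ->
    aff (t n) u =1 aff (t n) v.
  rewrite ![weval _ _]weval_pres => /pres_classP; exact: aff_pres_eq.
have vanish w : (weval wr_mark w).1 = 0 ->
    U [set n | (aff (t n) w (0, 0)).2 = 0] -> weval wr_mark w = 1%g.
  have [K [q [qE q0 affE]]] := aff_wr_mark w => w1 wU.
  have {}q0' : q = 0.
    apply: (poly_int_vanishing m0 xU); apply: filterS wU => n /=.
    rewrite affE //= => /eqP.
    by rewrite mulf_eq0 invr_eq0 expf_eq0 (negPf (t0 n)) andbF.
  move: w1 qE q0; case: (weval _ w) => k c /= -> qE q0.
  congr (_, _); apply/val_inj/funext => i /=.
  have [iK|iK] := ltP i (- K%:Z); first exact: q0.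
  have -> : i = Posz (absz (i + K%:Z)) - K%:Z.
    by rewrite gez0_abs ?addrK // -lerBlDr sub0r.
  by rewrite qE q0' coef0.
(* Words equal in [L] act equally on the rationals for almost all ratios [t n], and [vanish] then
   equates their images; so [p0] is well defined. *)
have wr_eq u v : weval (@mgens 2 L) u = weval (@mgens 2 L) v ->
    weval wr_mark u = weval wr_mark v.
  move=> /(limit_eqP UU evU) uv.
  have uvU : U [set n | aff (t n) (u ++ winv v) (0, 0) = (0, 0)].
    apply: filterS uv => n /= uv; rewrite (@aff_eq n _ [::]) //.
    by rewrite weval_cat weval_winv uv mulgV /weval big_nil.
  apply/divg1_eq; rewrite -weval_winv -weval_cat; apply: vanish.
    have [n /=] := filter_ex uvU.
    have [K [q [_ _ affE]]] := aff_wr_mark (u ++ winv v).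
    by rewrite affE // => -[].
  by apply: filterS uvU => n /= ->.
pose p0 (g : L) := weval wr_mark (limit_word g).
have p0E w : p0 (weval (@mgens 2 L) w) = weval wr_mark w.
  by apply: wr_eq; rewrite limit_wordK.
have p0M : {morph p0 : g h / (g * h)%g}.
  move=> g h; rewrite -{1}(limit_wordK g) -{1}(limit_wordK h) -weval_cat p0E.
  exact: weval_cat.
have [p pE] : exists p : UMagmaMorphism.type L ZwrZ, forall g, p g = p0 g.
  by exists (group_morphism p0M).
pose H : set L := vertex_stab M U; pose B : set L := edge_stab e U.
have HM g h : H g -> H h -> H (g * h)%g.
  by apply: (limit_setM UU evU) => n; exact: powersM.
have HV g : H g -> H g^-1%g.
  by apply: (limit_setV UU evU) => n; exact: powersV.
have H1 : H 1%g by apply: (limit_set1 UU evU) => n; exact: powers1.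
(* In almost all [M n] such an [h] is a power of [b], hence acts as a translation. A trivial image
   under [p] makes this translation fix [0], so the exponent is zero. *)
have Hp h : H h -> p h = 1%g -> h = 1%g.
  rewrite pE => Hh p1.
  have [K [q [qE q0 affE]]] := aff_wr_mark (limit_word h).
  have q00 : q = 0 by apply/polyP => j; rewrite -qE [weval _ _]p1 coef0.
  rewrite -(limit_wordK h).
  have -> : 1%g = weval (@mgens 2 L) [::] by rewrite /weval big_nil.
  apply/(limit_eqP UU evU); apply: filterS Hh => n /= [k [l E]].
  have wE : weval (@mgens 2 (M n)) (limit_word h) =
      weval (@mgens 2 (M n)) (nseq k (bs_b, false) ++ nseq l (bs_b, true)).
    by rewrite E weval_cat !weval_nseq !weval1 expVgn.
  have := aff_eq n _ _ wE (0, 0); rewrite affE // q00 map_poly0 horner0 mulr0.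
  rewrite aff_cat !aff_nseq_b /= => -[_ /esym/eqP].
  rewrite add0r expr0 expr1 mul1r mulN1r addrC subr_eq0 eqr_nat => /eqP kl.
  by rewrite E kl mulgV /weval big_nil.
have Hb z : H (weval (@mgens 2 L) (wpow bs_b z)).
  apply/(limit_setE UU evU); apply: filterE => n; exact: pow_b.
have Hgen (P : set L) : P 1%g -> (forall g h, H h -> P g -> P (g * h)%g) ->
    (forall g, P g -> P (g * mgens L bs_a)%g) ->
    (forall g, P g -> P (g * (mgens L bs_a)^-1)%g) -> P = setT.
  move=> P1 PH Pa Pa'; apply/seteqP; split=> // g _; rewrite -(limit_wordK g).
  elim/last_ind: (limit_word g) => [|w [y b] IHw]; first by rewrite /weval big_nil.
  rewrite -cats1 weval_cat weval1 /=.
  case: (eqVneq y bs_a) => [->|/bs_b_neq ->].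
    by case: b; [exact: Pa'|exact: Pa].
  apply: PH => //; case: b.
    by have := Hb (-1); rewrite weval_wpow /= expg1.
  by have := Hb 1; rewrite weval_wpow /= expg1.
have psurj : range p = setT.
  apply/seteqP; split=> // y _; have [w <-] := wr_mark_surj y.
  by exists (weval (@mgens 2 L) w) => //; rewrite pE p0E.
have [X [i ip]] := @kernel_free L ZwrZ p H B (mgens L bs_a) H1 HM HV
  (edge_stab_vertex UU (fun n => pow_b n (x n))) (edge_stabJ UU eJ_b evU) Hp Hgen
  (fun X f => limit_cocycle UU M_cocycle evU (f := f)) psurj.
by exists X, i, p.
Qed.

Theorem theorem3 (R : realType) (m : int) (hm : m != 0) (xi : madic m)
    (x : nat -> int) (hx : BSbar_seq xi x)
    (L : marked_group 2) (hL : mcvg R (fun n => BS m (x n)) L) :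
  exists (X : choiceType) (i : {multiplicative free_group X -> L})
    (p : {multiplicative L -> ZwrZ}), short_exact i p.
Proof.
have [x0 xoo _] := hx.
(* An ultrafilter containing the cofinite sets retains every property that holds for all large
   [n]. *)
have [U [UU subU]] := ultraFilterLemma eventually_filter.
apply: (BSbar_kernel_free UU hm x0) => [M|w]; apply: subU; first exact: xoo.
exact: mcvg_weval hL.
Qed.
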